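(* Let $k$ be a given time instant. If the primal-dual error $\|\bar w_k-w^\ast_k\|_2$, the number of primal iterations $M$, the penalty parameter $\rho$ and the parameter difference $\|s_{k+1}-s_k\|_2$ satisfy (i) $\|s_{k+1}-s_k\|_2<\min\left\{r_A,\,r_B,\,\frac{q_B\rho}{\lambda_A\lambda_F}\right\}$, (ii) $\|\bar w_k-w^\ast_k\|_2<q_B\rho$, (iii) $\rho>\tilde\rho$, (iv) $\left(1+\frac{\lambda_G\lambda_B}{\rho}\right)\|\bar w_k-w^\ast_k\|_2+\lambda_G\lambda_B\|s_{k+1}-s_k\|_2<\delta$, then $$\|\bar w_{k+1}-w^\ast_{k+1}\|_2\leq\beta_w(\rho,M)\,\|\bar w_k-w^\ast_k\|_2+\beta_s(\rho,M)\,\|s_{k+1}-s_k\|_2,$$ where $$\beta_w(\rho,M):=C(1+\rho\lambda_g)\left(1+\frac{\lambda_B\lambda_G}{\rho}\right)M^{-\psi(\hat\theta)}+\frac{\lambda_B\lambda_G}{\rho},$$ $$\beta_s(\rho,M):=C(1+\rho\lambda_g)\lambda_B\lambda_G M^{-\psi(\hat\theta)}+\frac{\lambda_B\lambda_G\lambda_A\lambda_F}{\rho}.$$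
   Context: Notation. $\mathcal B(x,r)$ is the open ball with center $x$ and radius $r$; $\iota_\Omega$ is the indicator function ($0$ on $\Omega$, $+\infty$ outside); $\mathcal N_\Omega(\bar x)=\{v: v^\top(x-\bar x)\le 0\ \forall x\in\Omega\}$ is the normal cone to a convex set $\Omega$ at $\bar x\in\Omega$; $d(x,\Sigma)=\inf_{y\in\Sigma}\|x-y\|_2$; $\partial$ is the (limiting) subdifferential of Rockafellar-Wets; a critical point of $L$ is a point $x^\ast$ with $0\in\partial L(x^\ast)$. Problem. Let $z=(z_1,\ldots,z_P)$ with $z_i\in\mathbb R^{n_i}$, $n_z=\sum_i n_i$; let $\mathcal Z_i\subset\mathbb R^{n_i}$ be compact convex and $\mathcal Z=\mathcal Z_1\times\cdots\times\mathcal Z_P$. The function $f:\mathbb R^{n_z}\to\mathbb R$ is multi-convex (convex in each $z_i$ when the other blocks are fixed), twice continuously differentiable and semi-algebraic. For each $s\in\mathcal S\subset\mathbb R^p$, $g(\cdot,s):\mathbb R^{n_z}\to\mathbb R^m$ is multi-linear in $(z_1,\ldots,z_P)$. Parameters $s_k\in\mathcal S$, $k\in\mathbb N$, are given, and the parametric program is: minimise $f(z)$ subject to $g(z,s_k)=0$, $z_i\in\mathcal Z_i$ for all $i$. The augmented Lagrangian is $L_\rho(z,\mu,s)=f(z)+\left(\mu+\frac{\rho}{2}g(z,s)\right)^\top g(z,s)$, with penalty $\rho>0$. Generalised equations. With $w=(z,\mu)\in\mathbb R^{n_z}\times\mathbb R^m$ let $F(w,s)=\begin{bmatrix}\nabla_z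 f(z)+\nabla_z g(z,s)^\top\mu\\ g(z,s)\end{bmatrix}$ and consider (GE1): $0\in F(w,s)+\mathcal N_{\mathcal Z\times\mathbb R^m}(w)$. A generalised equation $0\in H(x)+\mathcal N_{\mathcal C}(x)$ ($\mathcal C$ closed convex, $H$ differentiable) is strongly regular at a solution $x^\ast\in \mathcal C$ if there are $\eta,\kappa>0$ such that for every $r\in\mathcal B(0,\eta)$ there is a unique $x\in\mathcal B(x^\ast,\kappa)$ with $r\in H(x^\ast)+\nabla H(x^\ast)(x-x^\ast)+\mathcal N_{\mathcal C}(x)$, and the map $r\mapsto x$ from $\mathcal B(0,\eta)$ to $\mathcal B(x^\ast,\kappa)$ is Lipschitz continuous. Standing assumptions and constants. - For every $k$, (GE1) with $s=s_k$ is strongly regular at a solution $w^\ast_k=w^\ast(s_k)=(z^\ast_k,\mu^\ast_k)$. The constants $\delta_A,r_A,\lambda_A>0$ (independent of $k$) are such that for all $k$ and all $s\in\mathcal B(s_k,r_A)$ there is a unique $w^\ast(s)\in\mathcal B(w^\ast_k,\delta_A)$ solving (GE1), and for all $s,s'\in\mathcal B(s_k,r_A)$, $\|w^\ast(s)-w^\ast(s')\|_2\le\lambda_A\|F(w^\ast(s'),s)-F(w^\ast(s'),s')\|_2$. It is assumed that $\|s_{k+1}-s_k\|_2\le r_A$ for all $k$, and $w^\ast_{k+1}$ is the unique solution of (GE1) with $s=s_{k+1}$ in $\mathcal B(w^\ast_k,\delta_A)$. - $\lambda_F>0$ satisfies $\|F(w,s)-F(w,s')\|_2\le\lambda_F\|s-s'\|_2$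 for all $w\in\mathcal Z\times\mathbb R^m$, $s,s'\in\mathcal S$. - For $\bar\mu\in\mathbb R^m$ let $d_\rho(\bar\mu)=(\bar\mu-\mu^\ast_k)/\rho$, and for $d\in\mathbb R^m$ let $G_\rho(w,d,s)=\begin{bmatrix}\nabla_z f(z)+\nabla_z g(z,s)^\top\mu\\ g(z,s)+d+\frac{\mu^\ast_k-\mu}{\rho}\end{bmatrix}$. Consider (GE2): $0\in G_\rho(w,d,s)+\mathcal N_{\mathcal Z\times\mathbb R^m}(w)$. The constant $\tilde\rho>0$ is such that for all $\rho>\tilde\rho$ and all $k$, (GE2) with $d=0$, $s=s_k$ is strongly regular at $w^\ast_k$. The constants $\delta_B,r_B,q_B,\lambda_B>0$ (independent of $k$) are such that for all $k$, all $d\in\mathcal B(0,q_B)$ and $s\in\mathcal B(s_k,r_B)$ there is a unique $w^\ast(d,s)\in\mathcal B(w^\ast_k,\delta_B)$ solving (GE2), and for all $d,d'\in\mathcal B(0,q_B)$, $s,s'\in\mathcal B(s_k,r_B)$, $\|w^\ast(d,s)-w^\ast(d',s')\|_2\le\lambda_B\|G_\rho(w^\ast(d',s'),d,s)-G_\rho(w^\ast(d',s'),d',s')\|_2$. The constant $\lambda_G>0$ satisfies $\|G_\rho(w,d,s)-G_\rho(w,d',s')\|_2\le\lambda_G\|(d,s)-(d',s')\|_2$ for all $w\in\mathcal Z\times\mathbb R^m$, $d,d'\in\mathbb R^m$, $s,s'\in\mathcal S$. - $\lambda_g>0$ is the Lipschitz constant of $g(\cdot,s)$ on $\mathcal Z$.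 - Kurdyka-Lojasiewicz (KL) assumption: there are $\delta>0$ and $\hat\theta\in(1/2,1)$ such that for all $\mu\in\mathbb R^m$, $s\in\mathcal S$, at each critical point $x^\ast$ of $L:=L_\rho(\cdot,\mu,s)+\iota_{\mathcal Z}$ there are $c>0$ and an exponent $\theta(\mu,s)\in(1/2,1)$, $\theta(\mu,s)\le\hat\theta$, with $d(0,\partial L(x))\ge c\,(L(x)-L(x^\ast))^{\theta(\mu,s)}$ for all $x\in\mathcal B(x^\ast,\delta)$ with $L(x)>L(x^\ast)$. Set $\psi(\theta)=\frac{1-\theta}{2\theta-1}$. Algorithm. Given $\bar w_k=(\bar z_k,\bar\mu_k)$, $s_{k+1}$, $M\ge1$ and fixed $\alpha_i>0$: set $z^{(0)}=\bar z_k$; for $l=0,\ldots,M-1$ and $i=1,\ldots,P$ (in order) set $z_i^{(l+1)}=\operatorname{argmin}_{z_i\in\mathcal Z_i}L_\rho(z_1^{(l+1)},\ldots,z_{i-1}^{(l+1)},z_i,z_{i+1}^{(l)},\ldots,z_P^{(l)},\bar\mu_k,s_{k+1})+\frac{\alpha_i}{2}\|z_i-z_i^{(l)}\|_2^2$; then $\bar z_{k+1}=z^{(M)}$, $\bar\mu_{k+1}=\bar\mu_k+\rho g(\bar z_{k+1},s_{k+1})$, and $\bar w_{k+1}=(\bar z_{k+1},\bar\mu_{k+1})$. When the inner loop is run forever ($M=\infty$), $(z^{(l)})$ converges to a critical point $z^\infty(\bar\mu_k,s_{k+1})$ of $L_\rho(\cdot,\bar\mu_k,s_{k+1})+\iota_{\mathcal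 Z}$. The constant $C>0$ (independent of $k$ and $M$) is such that whenever $\bar z_k\in\mathcal B(z^\infty(\bar\mu_k,s_{k+1}),\delta)$, $\|\bar z_{k+1}-z^\infty(\bar\mu_k,s_{k+1})\|_2\le C M^{-\psi(\hat\theta)}\|\bar z_k-z^\infty(\bar\mu_k,s_{k+1})\|_2$.
   Formalization: The formal theorem additionally assumes that, at the given k, the point (z^∞, μ̄_k + ρ g(z^∞, s_{k+1})) built from the inner-loop limit lies in B(w*_k, δ_B); without this the inner loop may converge to a distant critical point and the estimate fails. *)

(* Defs.v *)
From HB Require Import structures.
From mathcomp Require Import all_boot all_order all_algebra.
From mathcomp Require Import all_classical all_reals all_analysis.
From mathcomp Require mpoly.

Set Implicit Arguments.
Unset Strict Implicit.
Unset Printing Implicit Defensive.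

Import Order.TTheory GRing.Theory Num.Theory.
Import numFieldNormedType.Exports.

Local Open Scope classical_set_scope.
Local Open Scope ring_scope.

(** Vectors of R^n are row vectors ['rV[R]_n].  The norm that MathComp-Analysis
    puts on ['rV[R]_n] is the max norm, so the Euclidean norm, balls and
    distances are defined here; the topology is the same. *)

Definition dotr (R : realType) n (u v : 'rV[R]_n) : R := (u *m v^T) 0 0.

Definition enorm (R : realType) n (v : 'rV[R]_n) : R :=
  Num.sqrt (\sum_(i < n) v 0 i ^+ 2).

Definition eball (R : realType) n (x : 'rV[R]_n) (r : R) : set 'rV[R]_n :=
  [set y | enorm (y - x) < r].

(** The distance to the empty set is [+oo]. *)
Definition dist_to (R : realType) n (x : 'rV[R]_n) (A : set 'rV[R]_n) : \bar R :=
  ereal_inf [set (enorm (x - y))%:E | y in A].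

Definition grad (R : realType) n (f : 'rV[R]_n -> R) (x : 'rV[R]_n) : 'rV[R]_n :=
  \row_j 'D_(delta_mx 0 j) f x.

Definition C2 (R : realType) n (f : 'rV[R]_n -> R) : Prop :=
  [/\ forall x, differentiable f x,
      forall x, differentiable (grad f) x &
      continuous (fun x => 'J (grad f) x)].

(** A semi-algebraic set is a finite union of sets, each defined by finitely
    many polynomial equations and strict polynomial inequalities; a function is
    semi-algebraic when its graph is. *)
Definition semialgebraic_set (R : realType) n (A : set 'rV[R]_n) : Prop :=
  exists D : seq (seq (mpoly.mpoly n R) * seq (mpoly.mpoly n R)),
    A = [set x | has (fun EI => all (fun p => mpoly.meval (x 0) p == 0) EI.1
                             && all (fun q => mpoly.meval (x 0) q < 0) EI.2) D].

Definition semialgebraic (R : realType) n (f : 'rV[R]_n -> R) : Prop :=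
  semialgebraic_set [set row_mx x (f x)%:M | x in [set: 'rV[R]_n]].

(** The normal cone is taken to be empty outside [A]. *)
Definition normal_cone (R : realType) n (A : set 'rV[R]_n) (x : 'rV[R]_n) :
    set 'rV[R]_n :=
  [set v | A x /\ forall y, A y -> dotr v (y - x) <= 0].

Definition indicator (R : realType) n (A : set 'rV[R]_n) (x : 'rV[R]_n) : \bar R :=
  if x \in A then 0%E else +oo%E.

(** Regular and limiting subdifferentials (Rockafellar--Wets, Def. 8.3).  The
    regular one is spelled out from
    [h y >= h x + <v, y - x> + o(|y - x|)]. *)
Definition regular_subdiff (R : realType) n (h : 'rV[R]_n -> \bar R)
    (x : 'rV[R]_n) : set 'rV[R]_n :=
  [set v | h x \is a fin_num /\
    forall e : R, 0 < e -> \forall y \near x,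
      (h x + (dotr v (y - x) - e * enorm (y - x))%:E <= h y)%E].

Definition subdiff (R : realType) n (h : 'rV[R]_n -> \bar R) (x : 'rV[R]_n) :
    set 'rV[R]_n :=
  [set v | h x \is a fin_num /\
    exists xs vs : nat -> 'rV[R]_n,
      [/\ xs i @[i --> \oo] --> x, h (xs i) @[i --> \oo] --> h x,
          forall i, regular_subdiff h (xs i) (vs i) &
          vs i @[i --> \oo] --> v]].

Definition critical (R : realType) n (h : 'rV[R]_n -> \bar R) (x : 'rV[R]_n) :
    Prop := subdiff h x 0.

(** [x] solves the generalised equation [0 \in H(x) + N_A(x)]. *)
Definition solves_GE (R : realType) n (H : 'rV[R]_n -> 'rV[R]_n)
    (A : set 'rV[R]_n) (x : 'rV[R]_n) : Prop :=
  normal_cone A x (- H x).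

(** [x] solves the generalised equation linearised at [xs], perturbed by [r]:
    [r \in H(xs) + H'(xs)(x - xs) + N_A(x)]. *)
Definition solves_lin_GE (R : realType) n (H : 'rV[R]_n -> 'rV[R]_n)
    (A : set 'rV[R]_n) (xs r x : 'rV[R]_n) : Prop :=
  normal_cone A x (r - (H xs + 'd H xs (x - xs))).

Definition strongly_regular (R : realType) n (H : 'rV[R]_n -> 'rV[R]_n)
    (A : set 'rV[R]_n) (xs : 'rV[R]_n) : Prop :=
  solves_GE H A xs /\
  exists eta kappa : R, [/\ 0 < eta, 0 < kappa,
    forall r, eball 0 eta r ->
      exists! x, eball xs kappa x /\ solves_lin_GE H A xs r x &
    exists lip : R, forall r r' x x',
      eball 0 eta r -> eball 0 eta r' ->
      eball xs kappa x -> solves_lin_GE H A xs r x ->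
      eball xs kappa x' -> solves_lin_GE H A xs r' x' ->
      enorm (x - x') <= lip * enorm (r - r')].

(** A point [z = (z_1, ..., z_P)] is a row vector of size [\sum_i n_ i]; its
    blocks are [submxrow z i]. *)
Definition set_block (R : realType) (P : nat) (n_ : 'I_P -> nat)
    (z : 'rV[R]_(\sum_i n_ i)) (i : 'I_P) (x : 'rV[R]_(n_ i)) :
    'rV[R]_(\sum_i n_ i) :=
  \mxrow_j eqtype.dfwith (submxrow z) x j.

Definition prod_set (R : realType) (P : nat) (n_ : 'I_P -> nat)
    (Z_ : forall i, set 'rV[R]_(n_ i)) : set 'rV[R]_(\sum_i n_ i) :=
  [set z | forall i, Z_ i (submxrow z i)].

Definition multiconvex (R : realType) (P : nat) (n_ : 'I_P -> nat)
    (f : 'rV[R]_(\sum_i n_ i) -> R) : Prop :=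
  forall z i, convex_function setT (fun x : 'rV[R]_(n_ i) => f (set_block z x)).

Definition multilinear (R : realType) (P : nat) (n_ : 'I_P -> nat) (m : nat)
    (g : 'rV[R]_(\sum_i n_ i) -> 'rV[R]_m) : Prop :=
  forall z i, linear (fun x : 'rV[R]_(n_ i) => g (set_block z x)).

(** The set [Z x R^m]; [w = (z, mu)] is [row_mx z mu]. *)
Definition primal_dual_set (R : realType) nz m (Z : set 'rV[R]_nz) :
    set 'rV[R]_(nz + m) :=
  [set w | Z (lsubmx w)].

Definition aug_lag (R : realType) nz m p (f : 'rV[R]_nz -> R)
    (g : 'rV[R]_nz -> 'rV[R]_p -> 'rV[R]_m) (rho : R)
    (z : 'rV[R]_nz) (mu : 'rV[R]_m) (s : 'rV[R]_p) : R :=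
  f z + dotr (mu + (rho / 2) *: g z s) (g z s).

(** [L_rho(., mu, s) + iota_Z] *)
Definition aug_lag_ind (R : realType) nz m p (f : 'rV[R]_nz -> R)
    (g : 'rV[R]_nz -> 'rV[R]_p -> 'rV[R]_m) (Z : set 'rV[R]_nz) (rho : R)
    (mu : 'rV[R]_m) (s : 'rV[R]_p) (z : 'rV[R]_nz) : \bar R :=
  ((aug_lag f g rho z mu s)%:E + indicator Z z)%E.

(** The map [F(w, s)].  In the library's row-vector convention ['J (g(., s)) z]
    has the partial derivative d g_l / d z_j in row j and column l, so that the
    row vector of [(nabla g)^T mu] is [mu *m ('J (g(., s)) z)^T]. *)
Definition Fmap (R : realType) nz m p (f : 'rV[R]_nz -> R)
    (g : 'rV[R]_nz -> 'rV[R]_p -> 'rV[R]_m) (s : 'rV[R]_p)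
    (w : 'rV[R]_(nz + m)) : 'rV[R]_(nz + m) :=
  let z := lsubmx w in let mu := rsubmx w in
  row_mx (grad f z + mu *m ('J (fun y => g y s) z)^T) (g z s).

(** The map [G_rho(w, d, s)]; [mus] is the reference multiplier [mu*_k]. *)
Definition Gmap (R : realType) nz m p (f : 'rV[R]_nz -> R)
    (g : 'rV[R]_nz -> 'rV[R]_p -> 'rV[R]_m) (rho : R) (mus : 'rV[R]_m)
    (d : 'rV[R]_m) (s : 'rV[R]_p)
    (w : 'rV[R]_(nz + m)) : 'rV[R]_(nz + m) :=
  let z := lsubmx w in let mu := rsubmx w in
  row_mx (grad f z + mu *m ('J (fun y => g y s) z)^T)
         (g z s + d + rho^-1 *: (mus - mu)).

Definition argmin_on (R : realType) (T : Type) (A : set T) (phi : T -> R) (x : T) :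
    Prop := A x /\ forall y, A y -> phi x <= phi y.

(** [z'] results from [z] by one in-order pass over the blocks: when block [i]
    is minimised, the blocks before [i] are those of [z'] and the blocks after
    [i] those of [z]. *)
Definition sweep (R : realType) (P : nat) (n_ : 'I_P -> nat)
    (Z_ : forall i, set 'rV[R]_(n_ i)) (L : 'rV[R]_(\sum_i n_ i) -> R)
    (alpha : 'I_P -> R) (z z' : 'rV[R]_(\sum_i n_ i)) : Prop :=
  forall i : 'I_P,
    let mixed : 'rV[R]_(\sum_i n_ i) :=
      \mxrow_j (if (j < i)%N then submxrow z' j else submxrow z j) in
    argmin_on (Z_ i)
      (fun x => L (set_block mixed x)
                + alpha i / 2 * enorm (x - submxrow z i) ^+ 2)
      (submxrow z' i).

Definition psi (R : realType) (theta : R) : R := (1 - theta) / (2 * theta - 1).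

(** The KL property, uniformly in [(mu, s)]: the radius [delta] and the bound
    [thetah] on the exponents do not depend on [(mu, s)]. *)
Definition KL_uniform (R : realType) nz m p
    (L : 'rV[R]_m -> 'rV[R]_p -> 'rV[R]_nz -> \bar R) (Sp : set 'rV[R]_p)
    (delta thetah : R) : Prop :=
  forall mu s, Sp s ->
    exists theta : R, [/\ 2^-1 < theta, theta < 1, theta <= thetah &
      forall xs, critical (L mu s) xs ->
        exists2 c : R, 0 < c &
          forall x, eball xs delta x -> (L mu s xs < L mu s x)%E ->
            (c%:E * poweR (L mu s x - L mu s xs) theta
               <= dist_to 0 (subdiff (L mu s) x))%E].

Definition beta_w (R : realType) (C lg lB lG thetah rho : R) (M : nat) : R :=
  C * (1 + rho * lg) * (1 + lB * lG / rho) * (M%:R `^ (- psi thetah))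
  + lB * lG / rho.

Definition beta_s (R : realType) (C lg lB lG lA lF thetah rho : R) (M : nat) : R :=
  C * (1 + rho * lg) * lB * lG * (M%:R `^ (- psi thetah))
  + lB * lG * lA * lF / rho.

(* Main.v *)
(** Let [winf = (zinf, mubar_k + rho g(zinf, s_{k+1}))], where [zinf] is the limit
    of the inner loop, and let [d(w) = (mu - mu*_k) / rho] for [w = (z, mu)].  At
    [d = d(w)] the maps [G_rho] and [F] agree at [w], so [w*_k] and [w*_{k+1}] solve
    (GE2) at [(0, s_k)] and [(d(w*_{k+1}), s_{k+1})]; criticality of [zinf] says that
    [winf] solves it at [((mubar_k - mu*_k) / rho, s_{k+1})].  Strong regularity of
    (GE2) bounds the distances from [winf] to [w*_k] and to [w*_{k+1}]: the first puts
    [zbar_k] in the region where the rate of the inner loop holds, and the second is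
    added to the resulting bound on the distance from [wbar_{k+1}] to [winf].
    That [w*_{k+1}] lies in the ball of radius [deltaB] where (GE2) has a unique
    solution is not assumed: it follows by continuation along the segment from [s_k]
    to [s_{k+1}].  Criticality gives the first-order condition because multilinear
    maps are continuously differentiable. *)

Require Import Defs.
From HB Require Import structures.
From mathcomp Require Import all_boot all_order all_algebra.
From mathcomp Require Import all_classical all_reals all_analysis.
From mathcomp Require Import ring lra.

Set Implicit Arguments.
Unset Strict Implicit.
Unset Printing Implicit Defensive.

Import Order.TTheory GRing.Theory Num.Theory.
Import numFieldNormedType.Exports.

Local Open Scope classical_set_scope.
Local Open Scope ring_scope.

(** * Euclidean inner product and norm on row vectors *)

Lemma dotrE (R : realType) n (u v : 'rV[R]_n) : dotr u v = \sum_j u 0 j * v 0 j.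
Proof. by rewrite /dotr mxE; apply: eq_bigr => j _; rewrite mxE. Qed.

Lemma dotrDl (R : realType) n (u v w : 'rV[R]_n) :
  dotr (u + v) w = dotr u w + dotr v w.
Proof. by rewrite /dotr mulmxDl mxE. Qed.

Lemma dotrNl (R : realType) n (u v : 'rV[R]_n) : dotr (- u) v = - dotr u v.
Proof. by rewrite /dotr mulNmx mxE. Qed.

Lemma dotrZr (R : realType) n a (u v : 'rV[R]_n) : dotr u (a *: v) = a * dotr u v.
Proof. by rewrite /dotr linearZ /= -scalemxAr mxE. Qed.

Lemma dotr0r (R : realType) n (u : 'rV[R]_n) : dotr u 0 = 0.
Proof. by rewrite /dotr trmx0 mulmx0 mxE. Qed.

Lemma dotr_row_mx (R : realType) n m (a c : 'rV[R]_n) (b d : 'rV[R]_m) :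
  dotr (row_mx a b) (row_mx c d) = dotr a c + dotr b d.
Proof. by rewrite /dotr tr_row_mx mul_row_col mxE. Qed.

Lemma enorm_sqr (R : realType) n (v : 'rV[R]_n) : enorm v ^+ 2 = dotr v v.
Proof.
rewrite dotrE /enorm sqr_sqrtr; last by apply: sumr_ge0 => i _; exact: sqr_ge0.
by apply: eq_bigr => i _; rewrite expr2.
Qed.

Lemma enorm_ge0 (R : realType) n (v : 'rV[R]_n) : 0 <= enorm v.
Proof. exact: sqrtr_ge0. Qed.

Lemma enorm0 (R : realType) n : enorm (0 : 'rV[R]_n) = 0.
Proof. by rewrite /enorm big1 ?sqrtr0 // => i _; rewrite mxE expr0n. Qed.

Lemma enormZ (R : realType) n a (v : 'rV[R]_n) : enorm (a *: v) = `|a| * enorm v.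
Proof.
rewrite /enorm -sqrtr_sqr -sqrtrM ?sqr_ge0 // mulr_sumr.
by congr Num.sqrt; apply: eq_bigr => i _; rewrite mxE exprMn.
Qed.

Lemma enormN (R : realType) n (v : 'rV[R]_n) : enorm (- v) = enorm v.
Proof. by rewrite -scaleN1r enormZ normrN1 mul1r. Qed.

Lemma enorm_distC (R : realType) n (u v : 'rV[R]_n) : enorm (u - v) = enorm (v - u).
Proof. by rewrite -opprB enormN. Qed.

Lemma enorm_eq0 (R : realType) n (v : 'rV[R]_n) : enorm v = 0 -> v = 0.
Proof.
move=> v0; have : dotr v v = 0 by rewrite -enorm_sqr v0 expr0n.
rewrite dotrE => /psumr_eq0P vv0; apply/rowP => j; rewrite mxE.
apply/eqP; rewrite -[_ == 0]orbb -mulf_eq0; apply/eqP/vv0 => // i _.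
by rewrite -expr2 sqr_ge0.
Qed.

(** Expanding the nonnegative sum of the squares [(enorm v * u 0 j - enorm u * v 0 j) ^+ 2] gives
    [2 * (a * b) * (a * b - dotr u v)] with [a], [b] the two norms; the factor [a * b] is positive
    unless a vector vanishes. *)
Lemma dotr_le_enorm (R : realType) n (u v : 'rV[R]_n) :
  dotr u v <= enorm u * enorm v.
Proof.
have [u0|u0] := eqVneq (enorm u) 0.
  by rewrite u0 (enorm_eq0 u0) mul0r /dotr mul0mx mxE.
have [v0|v0] := eqVneq (enorm v) 0; first by rewrite v0 (enorm_eq0 v0) dotr0r mulr0.
have uv_gt0 : 0 < enorm u * enorm v by rewrite mulr_gt0 // lt0r ?u0 ?v0 enorm_ge0.
have : 0 <= \sum_j (enorm v * u 0 j - enorm u * v 0 j) ^+ 2.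
  by apply: sumr_ge0 => j _; exact: sqr_ge0.
have -> : \sum_j (enorm v * u 0 j - enorm u * v 0 j) ^+ 2 =
    enorm v ^+ 2 * dotr u u + enorm u ^+ 2 * dotr v v
    - 2 * (enorm u * enorm v) * dotr u v.
  rewrite !dotrE !mulr_sumr -sumrN -!big_split /=.
  by apply: eq_bigr => j _; ring.
rewrite -!enorm_sqr; set a := enorm u in uv_gt0 *; set b := enorm v in uv_gt0 *.
have -> : b ^+ 2 * a ^+ 2 + a ^+ 2 * b ^+ 2 - 2 * (a * b) * dotr u v =
          2 * (a * b) * (a * b - dotr u v) by ring.
by rewrite pmulr_rge0 ?subr_ge0 // mulr_gt0.
Qed.

Lemma ler_enormD (R : realType) n (u v : 'rV[R]_n) :
  enorm (u + v) <= enorm u + enorm v.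
Proof.
rewrite -(@ler_pXn2r _ 2) ?nnegrE ?addr_ge0 ?enorm_ge0 // [leLHS]enorm_sqr.
have -> : dotr (u + v) (u + v) = dotr u u + dotr v v + 2 * dotr u v.
  rewrite !dotrE mulr_sumr -!big_split /=.
  by apply: eq_bigr => j _; rewrite !mxE; ring.
by have := dotr_le_enorm u v; rewrite -!enorm_sqr; nra.
Qed.

Lemma ler_enorm_distD (R : realType) n (w u v : 'rV[R]_n) :
  enorm (u - v) <= enorm (u - w) + enorm (w - v).
Proof. by rewrite -(subrKA w) ler_enormD. Qed.

Lemma enorm_row_mx_sqr (R : realType) n m (a : 'rV[R]_n) (b : 'rV[R]_m) :
  enorm (row_mx a b) ^+ 2 = enorm a ^+ 2 + enorm b ^+ 2.
Proof. by rewrite !enorm_sqr dotr_row_mx. Qed.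

Lemma enorm_row_mx_le (R : realType) n m (a : 'rV[R]_n) (b : 'rV[R]_m) :
  enorm (row_mx a b) <= enorm a + enorm b.
Proof.
rewrite -(@ler_pXn2r _ 2) ?nnegrE ?addr_ge0 ?enorm_ge0 // enorm_row_mx_sqr.
by have := enorm_ge0 a; have := enorm_ge0 b; nra.
Qed.

Lemma enorm_lsubmx_le (R : realType) n m (w : 'rV[R]_(n + m)) :
  enorm (lsubmx w) <= enorm w.
Proof.
rewrite -(@ler_pXn2r _ 2) ?nnegrE ?enorm_ge0 //.
by rewrite -{2}(hsubmxK w) enorm_row_mx_sqr lerDl sqr_ge0.
Qed.

Lemma enorm_rsubmx_le (R : realType) n m (w : 'rV[R]_(n + m)) :
  enorm (rsubmx w) <= enorm w.
Proof.
rewrite -(@ler_pXn2r _ 2) ?nnegrE ?enorm_ge0 //.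
by rewrite -{2}(hsubmxK w) enorm_row_mx_sqr lerDr sqr_ge0.
Qed.

(** * Differential calculus of multilinear functions *)

(** The varying blocks are given as a list so that differentiability in [z] can be proved by
    releasing one block at a time. *)
Definition mix_blocks (R : realType) (P : nat) (n_ : 'I_P -> nat) (A : seq 'I_P)
    (z c : 'rV[R]_(\sum_i n_ i)) : 'rV[R]_(\sum_i n_ i) :=
  \mxrow_j (if j \in A then submxrow z j else submxrow c j).

Lemma submxrow_set_block (R : realType) (P : nat) (n_ : 'I_P -> nat)
    (z : 'rV[R]_(\sum_i n_ i)) (i : 'I_P) (x : 'rV[R]_(n_ i)) j :
  submxrow (set_block z x) j = eqtype.dfwith (submxrow z) x j.
Proof. by rewrite /set_block mxrowK. Qed.

Lemma differentiable_sum_fun (R : realType) (V W : normedModType R) n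
    (h : 'I_n -> V -> W) x :
  (forall i, differentiable (h i) x) ->
  differentiable (fun y => \sum_(i < n) h i y) x.
Proof.
move=> dh; rewrite (_ : (fun _ => _) = \sum_(i < n) h i).
  exact: differentiable_sum.
by apply/funext => y; rewrite fct_sumE.
Qed.

Lemma set_block_id (R : realType) (P : nat) (n_ : 'I_P -> nat)
    (z : 'rV[R]_(\sum_i n_ i)) i : set_block z (submxrow z i) = z.
Proof.
apply/mxrowP => j; rewrite submxrow_set_block.
by case: eqtype.dfwithP.
Qed.

(** Induction on [A], for all [c] at once. When block [i] is released, linearity in that block
    expands it in the canonical basis: the function is a sum of coordinates of [z] times the
    function for [A], with a basis vector frozen in block [i] of [c]. *)
Lemma differentiable_mix_blocks (R : realType) (P : nat) (n_ : 'I_P -> nat)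
    (h : 'rV[R]_(\sum_i n_ i) -> R) (A : seq 'I_P) :
  (forall z i, scalar (fun x : 'rV[R]_(n_ i) => h (set_block z x))) ->
  forall c z, differentiable (fun z => h (mix_blocks A z c)) z.
Proof.
move=> h_lin; elim: A => [|i A IH] c z.
  rewrite (_ : (fun _ => _) = cst (h c)); first exact: differentiable_cst.
  by apply/funext => y; congr h; apply/mxrowP => j; rewrite mxrowK.
have [iA|iA] := boolP (i \in A).
  rewrite (_ : (fun _ => _) = (fun z => h (mix_blocks A z c))); first exact: IH.
  apply/funext => y; congr h; apply/mxrowP => j; rewrite !mxrowK inE.
  by case: eqVneq => [->|//]; rewrite iA.
pose F (j : 'I_(n_ i)) (z : 'rV[R]_(\sum_i n_ i)) := z 0 (tagnat.Rank i j)
  * h (mix_blocks A z (set_block c (delta_mx 0 j : 'rV_(n_ i)))).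
rewrite (_ : (fun _ => _) = (fun z => \sum_j F j z)); last first.
  apply/funext => y.
  have -> : mix_blocks (i :: A) y c = set_block (mix_blocks A y c) (submxrow y i).
    apply/mxrowP => j; rewrite submxrow_set_block !mxrowK inE.
    by case: eqtype.dfwithP => [|{}j ij]; rewrite ?eqxx // mxrowK eq_sym (negPf ij).
  rewrite {1}(row_sum_delta (submxrow y i)).
  (* For fixed other blocks the function is packed as a linear map into [R^o], which makes linearity
     over the basis expansion available. *)
  pose mM := GRing.isLinear.Build _ _ _ _ _ (h_lin (mix_blocks A y c) i).
  pose mL : {linear 'rV_(n_ i) -> R^o} :=
    HB.pack (fun x : 'rV[R]_(n_ i) => h (set_block (mix_blocks A y c) x)) mM.
  rewrite -[LHS]/(mL _) linear_sum; apply: eq_bigr => j _; rewrite linearZ /=.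
  rewrite /F mxE; congr (_ * h _); apply/mxrowP => l.
  rewrite submxrow_set_block !mxrowK.
  case: eqtype.dfwithP => [|{}l il]; first by rewrite (negPf iA) dfwith_in.
  by rewrite mxrowK dfwith_out.
apply: differentiable_sum_fun => j.
by apply: differentiableM; [exact: differentiable_coord|exact: IH].
Qed.

Lemma multilinear_differentiable (R : realType) (P : nat) (n_ : 'I_P -> nat)
    (h : 'rV[R]_(\sum_i n_ i) -> R) :
  (forall z i, scalar (fun x : 'rV[R]_(n_ i) => h (set_block z x))) ->
  forall z, differentiable h z.
Proof.
move=> h_lin z; rewrite (_ : h = (fun z => h (mix_blocks (enum 'I_P) z 0))).
  exact: differentiable_mix_blocks.
apply/funext => y; congr h; apply/mxrowP => j.
by rewrite mxrowK mem_enum.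
Qed.

(** Freezing block [i] at [v] amounts to mixing over all blocks except [i], with [v] stored in the
    constant point. *)
Lemma multilinear_block_differentiable (R : realType) (P : nat) (n_ : 'I_P -> nat)
    (h : 'rV[R]_(\sum_i n_ i) -> R) i (v : 'rV[R]_(n_ i)) :
  (forall z i, scalar (fun x : 'rV[R]_(n_ i) => h (set_block z x))) ->
  forall z, differentiable (fun z => h (set_block z v)) z.
Proof.
move=> h_lin z.
rewrite (_ : (fun _ => _) =
    (fun z => h (mix_blocks [seq j <- enum 'I_P | i != j] z (set_block 0 v)))).
  exact: differentiable_mix_blocks.
apply/funext => y; congr h; apply/mxrowP => j.
rewrite submxrow_set_block mxrowK mem_filter mem_enum andbT submxrow_set_block.
by case: eqtype.dfwithP => [|{}j ->]; rewrite ?eqxx //= dfwith_in.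
Qed.

Lemma submxrowZ (R : realType) (P : nat) (n_ : 'I_P -> nat) a
    (v : 'rV[R]_(\sum_i n_ i)) i : submxrow (a *: v) i = a *: submxrow v i.
Proof. by apply/rowP => j; rewrite !mxE. Qed.

Lemma sum_set_block0 (R : realType) (P : nat) (n_ : 'I_P -> nat)
    (v : 'rV[R]_(\sum_i n_ i)) : v = \sum_i set_block 0 (submxrow v i).
Proof.
apply/mxrowP => j; rewrite submxrow_sum (bigD1 j) //= [X in _ + X]big1 => [|i ij].
  by rewrite addr0 submxrow_set_block dfwith_in.
by rewrite submxrow_set_block dfwith_out // submxrow0.
Qed.

(** The direction splits into directions supported on one block; along each of these [h] is affine,
    so its difference quotient is constant for [t != 0]. *)
Lemma multilinear_derive (R : realType) (P : nat) (n_ : 'I_P -> nat)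
    (h : 'rV[R]_(\sum_i n_ i) -> R) (v z : 'rV[R]_(\sum_i n_ i)) :
  (forall z i, scalar (fun x : 'rV[R]_(n_ i) => h (set_block z x))) ->
  'D_v h z = \sum_i h (set_block z (submxrow v i)).
Proof.
move=> h_lin; have dh := @multilinear_differentiable _ _ _ _ h_lin z.
rewrite {1}(sum_set_block0 v).
rewrite deriveE // linear_sum; apply: eq_bigr => i _; rewrite -deriveE //.
set x := submxrow v i; apply: cvg_lim => //=.
apply: cvg_near_cst; near=> t.
have t0 : t != 0 by near: t; exact: nbhs_dnbhs_neq.
have -> : t *: set_block 0 x + z = set_block z (t *: x + submxrow z i).
  apply/mxrowP => j; rewrite submxrowD submxrowZ !submxrow_set_block.
  case: eqtype.dfwithP => [|{}j ij]; first by rewrite dfwith_in.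
  by rewrite dfwith_out // submxrow0 scaler0 add0r.
by rewrite h_lin set_block_id addrK /GRing.scale /= mulKf.
Unshelve. all: by end_near. Qed.

(** * First-order conditions over a convex set *)

Lemma derive_grad (R : realType) n (L : 'rV[R]_n -> R) x u :
  differentiable L x -> 'D_u L x = dotr (grad L x) u.
Proof.
move=> dL; rewrite deriveE // {1}(row_sum_delta u) linear_sum dotrE.
by apply: eq_bigr => j _; rewrite linearZ mxE /= -deriveE // mulrC.
Qed.

(** On the segment from [x] to [y] the indicator vanishes, so the subgradient inequality at
    [t *: u + x] concerns [L] alone; dividing by [t > 0] and letting [t] tend to 0 from the right
    gives the bound. *)
Lemma regular_subdiff_le_derive (R : realType) n (L : 'rV[R]_n -> R)
    (Z : set 'rV[R]_n) x v y :
  (forall x y t, Z x -> Z y -> 0 < t < 1 -> Z (t *: (y - x) + x)) ->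
  differentiable L x ->
  regular_subdiff (fun x => (L x)%:E + indicator Z x)%E x v ->
  Z y -> dotr v (y - x) <= 'D_(y - x) L x.
Proof.
move=> Z_conv dL [hx_fin hx] Zy; set u := y - x.
have Zx : Z x.
  by move: hx_fin; rewrite /indicator; case: ifPn => [/set_mem|].
apply/ler_addgt0Pr => e e_gt0.
(* The added 1 covers [u = 0]; with this choice [e' * enorm u <= e]. *)
pose e' := e / (enorm u + 1).
have u1_gt0 : 0 < enorm u + 1 by rewrite ltr_wpDl ?enorm_ge0.
have e'_gt0 : 0 < e' by rewrite divr_gt0.
rewrite -lerBlDr; apply: (@le_trans _ _ (dotr v u - e' * enorm u)).
  rewrite lerD2l lerN2 /e' -mulrA ler_piMr ?(ltW e_gt0) // ler_pdivrMl // mulr1.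
  by rewrite lerDl.
have lim0 : (fun t => t^-1 *: ((L \o shift x) (t *: u) - L x)) @ 0^'+ --> 'D_u L x.
  by apply: cvg_dnbhs_at_right; exact: diff_derivable.
have cvgx : t *: u + x @[t --> (0 : R)^'+] --> x.
  rewrite -[X in _ --> X]add0r -(scale0r u).
  apply: cvg_at_right_filter; apply: cvgD; last exact: cvg_cst.
  exact: scalel_continuous.
rewrite -(cvg_lim _ lim0) //; apply: limr_ge; first exact: cvgP lim0.
near=> t.
have t_gt0 : 0 < t by near: t; exact: nbhs_right_gt.
have t_lt1 : t < 1 by near: t; apply: nbhs_right_lt.
have : ((L x)%:E + indicator Z x + (dotr v (t *: u + x - x)
    - e' * enorm (t *: u + x - x))%:E
    <= (L (t *: u + x)%R)%:E + indicator Z (t *: u + x)%R)%E.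
  by near: t; exact: (cvgx _ (hx e' e'_gt0)).
rewrite /indicator !mem_set //; last by apply: Z_conv => //; rewrite t_gt0.
rewrite !adde0 -EFinD lee_fin addrK dotrZr enormZ gtr0_norm // => Lt.
rewrite /GRing.scale /= ler_pdivlMl //; lra.
Unshelve. all: by end_near. Qed.

(** The variational inequality holds for the regular subgradients [vs i] at [xs i]; continuity of
    the gradient carries it to the limit. *)
Lemma critical_normal_cone (R : realType) n (L : 'rV[R]_n -> R)
    (Z : set 'rV[R]_n) x :
  (forall x y t, Z x -> Z y -> 0 < t < 1 -> Z (t *: (y - x) + x)) ->
  (forall x, differentiable L x) ->
  (forall j, continuous (fun x => grad L x 0 j)) ->
  critical (fun x => (L x)%:E + indicator Z x)%E x ->
  normal_cone Z x (- grad L x).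
Proof.
move=> Z_conv dL grad_cont [hx_fin [xs [vs [xs_cvg _ hxs vs_cvg]]]]; split.
  by move: hx_fin; rewrite /indicator; case: ifPn => [/set_mem|].
move=> y Zy.
have coord_cvg (w : nat -> 'rV[R]_n) (a : 'rV[R]_n) j : w i @[i --> \oo] --> a ->
    w i 0 j @[i --> \oo] --> a 0 j.
  move=> wa; apply: (cvg_comp w (fun v : 'rV[R]_n => v 0 j) wa).
  exact: coord_continuous.
have dotrBE (a b c d : 'rV[R]_n) :
    dotr (a - b) (c - d) = \sum_j (a 0 j - b 0 j) * (c 0 j - d 0 j).
  by rewrite dotrE; apply: eq_bigr => j _; rewrite !mxE.
have lim_dotr : dotr (vs i - grad L (xs i)) (y - xs i) @[i --> \oo] -->
    dotr (0 - grad L x) (y - x).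
  rewrite dotrBE; under eq_fun do rewrite dotrBE.
  apply: cvg_big => [|j _]; first exact: add_continuous.
  apply: cvgM; apply: cvgB; first exact: coord_cvg.
  - apply: (cvg_comp xs (fun v => grad L v 0 j) xs_cvg).
    exact: grad_cont.
  - exact: cvg_cst.
  - exact: coord_cvg.
(* The 0 inserted here is the limit of the subgradients [vs]. *)
rewrite -[- _]add0r -(cvg_lim _ lim_dotr) //.
apply: limr_le; first exact: cvgP lim_dotr.
near=> i; rewrite dotrDl.
have := regular_subdiff_le_derive Z_conv (dL (xs i)) (hxs i) Zy.
rewrite derive_grad // => le_grad.
by rewrite dotrNl subr_le0.
Unshelve. all: by end_near. Qed.

(** * Gradient of the augmented Lagrangian *)

(** Applied to each term [(mu_l + rho / 2 * g_l) * g_l] of the augmented Lagrangian; the factor 2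
    turns [rho / 2] into [rho]. *)
Lemma derive_affine_mul (R : realType) (V : normedModType R) (a b : R) (h : V -> R) x v :
  derivable h x v ->
  'D_v ((cst a + b \*: h) * h) x = (a + 2 * b * h x) * 'D_v h x.
Proof.
move=> dh; have dbh : derivable (b \*: h) x v := derivableZ dh.
have da : derivable (cst a : V -> R) x v := derivable_cst a x v.
rewrite (deriveM (derivableD da dbh) dh) (deriveD da dbh) derive_cst (deriveZ b dh).
rewrite add0r -[LHS]/((a + b * h x) * 'D_v h x + h x * (b * 'D_v h x)); ring.
Qed.

Lemma differentiable_rV (R : realType) (V : normedModType R) m (g : V -> 'rV[R]_m) x :
  (forall l, differentiable (fun y => g y 0 l) x) -> differentiable g x.
Proof.
move=> dg; rewrite (_ : g = fun y => \sum_l g y 0 l *: delta_mx 0 l).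
  by apply: differentiable_sum_fun => l; exact: differentiableZl.
by apply/funext => y; exact: row_sum_delta.
Qed.

Lemma jacobian_coord (R : realType) n m (g : 'rV[R]_n -> 'rV[R]_m) x j l :
  differentiable g x -> 'J g x j l = 'D_(delta_mx 0 j) (fun y => g y 0 l) x.
Proof.
move=> dg; rewrite mxE -deriveE // derive_mx ?mxE //; exact: diff_derivable.
Qed.

(** The gradient is that of the ordinary Lagrangian at the updated multiplier [mu + rho *: g z t],
    which links the inner loop to the generalised equations. *)
Lemma differentiable_aug_lag (R : realType) n m p (f : 'rV[R]_n -> R)
    (g : 'rV[R]_n -> 'rV[R]_p -> 'rV[R]_m) rho mu t z :
  differentiable f z ->
  (forall l, differentiable (fun y => g y t 0 l) z) ->
  differentiable (fun y => aug_lag f g rho y mu t) z /\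
  grad (fun y => aug_lag f g rho y mu t) z =
    grad f z + (mu + rho *: g z t) *m ('J (fun y => g y t) z)^T.
Proof.
move=> df dg; pose G l := fun y => g y t 0 l.
have LE : (fun y => aug_lag f g rho y mu t) =
    f + \sum_(l < m) (cst (mu 0 l) + (rho / 2) \*: G l) * G l.
  apply/funext => y; rewrite /aug_lag dotrE fctE fct_sumE; congr (_ + _).
  by apply: eq_bigr => l _; rewrite !mxE.
have dGl l : differentiable ((cst (mu 0 l) + (rho / 2) \*: G l) * G l) z.
  apply: differentiableM; last exact: dg.
  by apply: differentiableD; [exact: differentiable_cst|exact/differentiableZ/dg].
have dL : differentiable (fun y => aug_lag f g rho y mu t) z.
  by rewrite LE; apply: differentiableD => //; exact: differentiable_sum.
split => //; apply/rowP => j; rewrite !mxE LE.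
rewrite deriveD; [|exact: diff_derivable|exact/diff_derivable/differentiable_sum].
congr (_ + _); rewrite derive_sum => [|l]; last exact: diff_derivable.
apply: eq_bigr => l _; rewrite [_^T _ _]mxE jacobian_coord; last exact: differentiable_rV.
rewrite derive_affine_mul; last exact/diff_derivable/dg.
by rewrite !mxE mulrCA divff ?mulr1 ?pnatr_eq0.
Qed.

Lemma continuous_grad_aug_lag (R : realType) n m p (f : 'rV[R]_n -> R)
    (g : 'rV[R]_n -> 'rV[R]_p -> 'rV[R]_m) rho mu t j :
  (forall z, differentiable f z) -> continuous (fun z => grad f z 0 j) ->
  (forall l z, differentiable (fun y => g y t 0 l) z) ->
  (forall l, continuous ('D_(delta_mx 0 j) (fun y => g y t 0 l))) ->
  continuous (fun z => grad (fun y => aug_lag f g rho y mu t) z 0 j).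
Proof.
move=> df gradf_cont dg Dg_cont.
have -> : (fun z => grad (fun y => aug_lag f g rho y mu t) z 0 j) =
    fun z => grad f z 0 j + \sum_l
      (mu 0 l + rho * g z t 0 l) * 'D_(delta_mx 0 j) (fun y => g y t 0 l) z.
  apply/funext => z; have [_ ->] := differentiable_aug_lag rho mu (df z) (dg ^~ z).
  rewrite !mxE; congr (_ + _); apply: eq_bigr => l _.
  by rewrite [_^T _ _]mxE jacobian_coord ?mxE //; exact: differentiable_rV.
move=> z; apply: (cvgD (gradf_cont z)).
apply: cvg_big => [|l _]; first exact: add_continuous.
apply: cvgM; last exact: Dg_cont.
apply: cvgD; first exact: cvg_cst.
apply: cvgM; first exact: cvg_cst.
exact: (differentiable_continuous (dg l z)).
Qed.

Lemma multilinear_coord (R : realType) (P : nat) (n_ : 'I_P -> nat) (m : nat)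
    (g : 'rV[R]_(\sum_i n_ i) -> 'rV[R]_m) l :
  multilinear g ->
  forall z i, scalar (fun x : 'rV[R]_(n_ i) => g (set_block z x) 0 l).
Proof. by move=> g_lin z i a x y; rewrite g_lin !mxE. Qed.

Lemma multilinear_derive_continuous (R : realType) (P : nat) (n_ : 'I_P -> nat)
    (h : 'rV[R]_(\sum_i n_ i) -> R) v :
  (forall z i, scalar (fun x : 'rV[R]_(n_ i) => h (set_block z x))) ->
  continuous ('D_v h).
Proof.
move=> h_lin.
have -> : 'D_v h = fun z => \sum_i h (set_block z (submxrow v i)).
  by apply/funext => z; exact: multilinear_derive.
move=> z; apply: differentiable_continuous; apply: differentiable_sum_fun => i.
exact: multilinear_block_differentiable.
Qed.

(** Supplies the primal component of the statement that [winf] solves (GE2). *)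
Lemma critical_aug_lag_normal_cone (R : realType) (P : nat) (n_ : 'I_P -> nat)
    (m p : nat) (Z_ : forall i : 'I_P, set 'rV[R]_(n_ i))
    (f : 'rV[R]_(\sum_i n_ i) -> R)
    (g : 'rV[R]_(\sum_i n_ i) -> 'rV[R]_p -> 'rV[R]_m) rho mu t z :
  (forall i, convex_set (Z_ i)) -> C2 f -> multilinear (fun z => g z t) ->
  critical (aug_lag_ind f g (prod_set Z_) rho mu t) z ->
  normal_cone (prod_set Z_) z
    (- (grad f z + (mu + rho *: g z t) *m ('J (fun y => g y t) z)^T)).
Proof.
move=> Z_conv [df dgradf _] g_lin z_crit.
pose G l y := g y t 0 l.
have G_lin l := multilinear_coord l g_lin.
have dG l y : differentiable (G l) y.
  exact: (@multilinear_differentiable _ _ _ (G l) (G_lin l)).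
have dL y := differentiable_aug_lag rho mu (df y) (dG ^~ y).
rewrite -(dL z).2; apply: critical_normal_cone z_crit => [x y a Zx Zy a01 i|y|j].
- have /andP[a_ge0 a_le1] : (0 <= a <= 1)%R by lra.
  have := Z_conv i (submxrow y i) (submxrow x i) (Itv01 a_ge0 a_le1).
  rewrite !inE => /(_ (Zy i) (Zx i)); congr (Z_ i _); apply/rowP => j.
  by rewrite /conv /= /unstable.onem !mxE; ring.
- exact: (dL y).1.
- apply: continuous_grad_aug_lag => // [y|l].
    apply: (cvg_comp (grad f) (fun v => v 0 j)
      (differentiable_continuous (dgradf y))).
    exact: coord_continuous.
  exact: (@multilinear_derive_continuous _ _ _ (G l) _ (G_lin l)).
Qed.

(** * Continuation along a segment *)

Lemma lipschitz_within_continuous (R : realType) (phi : R -> R) K :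
  {in `[0, 1]%R &, forall x y, `|phi x - phi y| <= K * `|x - y|} ->
  {within `[0, 1], continuous phi}.
Proof.
move=> phi_lip; apply/subspace_continuousP => x x01; apply/cvgrPdist_lt => e e_gt0.
(* The sign of [K] is arbitrary, so a positive constant replaces it. *)
have K_gt0 : 0 < `|K| + 1 by rewrite ltr_wpDl.
near=> y; apply: (@le_lt_trans _ _ ((`|K| + 1) * `|x - y|)).
  apply: le_trans (phi_lip x y x01 _) _; first by near: y; exact: withinT.
  by rewrite ler_wpM2r // ler_wpDr // ler_norm.
rewrite -ltr_pdivlMl // mulrC.
near: y; apply: cvg_within; apply: (@cvgr_dist_lt _ _ _ (nbhs x) _ id); first exact: cvg_id.
by rewrite divr_gt0.
Unshelve. all: by end_near. Qed.

(* On the times when [w] is in the open ball it coincides with [w'], whose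
   distance to the center attains a maximum [< D] on [0, 1]: the distance of [w]
   to the center skips the values between this maximum and [D]. *)
Lemma eball_continuation (R : realType) n (w0 : 'rV[R]_n) D K K' (w w' : R -> 'rV[R]_n) :
  {in `[0, 1]%R &, forall t u, enorm (w t - w u) <= K * `|t - u|} ->
  {in `[0, 1]%R &, forall t u, enorm (w' t - w' u) <= K' * `|t - u|} ->
  {in `[0, 1]%R, forall t, eball w0 D (w' t)} ->
  {in `[0, 1]%R, forall t, eball w0 D (w t) -> w t = w' t} ->
  eball w0 D (w 0) -> eball w0 D (w 1).
Proof.
have dist_cont L (v : R -> 'rV[R]_n) :
    {in `[0, 1]%R &, forall t u, enorm (v t - v u) <= L * `|t - u|} ->
    {within `[0, 1], continuous (fun t => enorm (v t - w0))}.
  move=> v_lip; apply: (@lipschitz_within_continuous _ _ L) => t u t01 u01.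
  apply: le_trans (v_lip t u t01 u01); rewrite ler_norml.
  have := ler_enorm_distD (v t) (v u) w0; have := ler_enorm_distD (v u) (v t) w0.
  by rewrite (enorm_distC (v u) (v t)) => le1 le2; apply/andP; split; lra.
move=> /dist_cont w_cont /dist_cont w'_cont w'D ww' w0D.
have i01 (t : R) : t \in `[0, 1]%R = (0 <= t <= 1) by rewrite in_itv.
have [c c01 w'_max] := EVT_max ler01 w'_cont.
have /= cD := w'D c c01; rewrite /eball /= ltNge; apply/negP => wD.
have w_le t : t \in `[0, 1]%R -> eball w0 D (w t) -> enorm (w t - w0) <= enorm (w' c - w0).
  by move=> t01 /(ww' t t01) ->; exact: w'_max.
have w0c : enorm (w 0 - w0) <= enorm (w' c - w0) by apply: w_le; rewrite // i01 lexx ler01.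
pose v := (enorm (w' c - w0) + D) / 2.
have [|t t01 tv] := @IVT _ (fun t => enorm (w t - w0)) 0 1 v ler01 w_cont.
  rewrite ge_min le_max; rewrite /eball /= in cD.
  by apply/andP; split; apply/orP; [left|right]; rewrite /v; lra.
have := w_le t t01; rewrite /eball /= tv /v; rewrite /eball /= in cD => w_skip.
have /w_skip : (enorm (w' c - w0) + D) / 2 < D by lra.
lra.
Qed.

(** * Generalised equations and the tracking estimate *)

(** The multiplier is unconstrained, so its normal component is 0 and only the primal component is
    tested. *)
Lemma solves_GE_row_mx (R : realType) n m (Z : set 'rV[R]_n)
    (H : 'rV[R]_(n + m) -> 'rV[R]_(n + m)) z mu a :
  H (row_mx z mu) = row_mx a 0 -> normal_cone Z z (- a) ->
  solves_GE H (primal_dual_set Z) (row_mx z mu).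
Proof.
move=> Hz [Zz a_normal]; split; first by rewrite /primal_dual_set /= row_mxKl.
move=> y; rewrite /primal_dual_set /= => Zy; rewrite Hz opp_row_mx oppr0.
rewrite -(hsubmxK y) opp_row_mx add_row_mx dotr_row_mx.
by rewrite [X in _ + X]/dotr mul0mx mxE addr0; exact: a_normal.
Qed.

Lemma Gmap_Fmap (R : realType) n m p (f : 'rV[R]_n -> R)
    (g : 'rV[R]_n -> 'rV[R]_p -> 'rV[R]_m) rho mus t w :
  Gmap f g rho mus (rho^-1 *: (rsubmx w - mus)) t w = Fmap f g t w.
Proof.
by rewrite /Gmap /Fmap -addrA -scalerDr addrA subrK subrr scaler0 addr0.
Qed.

Theorem theorem1 (R : realType)
  (* the parametric program *)
  (P : nat) (n_ : 'I_P -> nat) (m p : nat)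
  (Z_ : forall i : 'I_P, set 'rV[R]_(n_ i)) (Sp : set 'rV[R]_p)
  (f : 'rV[R]_(\sum_i n_ i) -> R)
  (g : 'rV[R]_(\sum_i n_ i) -> 'rV[R]_p -> 'rV[R]_m)
  (s : nat -> 'rV[R]_p) (rho : R)
  (HZcompact : forall i, compact (Z_ i))
  (HZconvex : forall i, convex_set (Z_ i))
  (Hfconvex : multiconvex f)
  (HfC2 : C2 f)
  (Hfsemialg : semialgebraic f)
  (Hg : forall t, Sp t -> multilinear (fun z => g z t))
  (Hs : forall k, Sp (s k))
  (Hrho : 0 < rho)
  (* strong regularity of (GE1) *)
  (wstar : nat -> 'rV[R]_(\sum_i n_ i + m))
  (HregA : forall k,
    strongly_regular (Fmap f g (s k)) (primal_dual_set (prod_set Z_)) (wstar k))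
  (deltaA rA lA : R)
  (HdeltaA : 0 < deltaA) (HrA : 0 < rA) (HlA : 0 < lA)
  (HSA : forall k, eball (s k) rA `<=` Sp)
  (HA : forall k,
    (forall t, eball (s k) rA t ->
      exists! w, eball (wstar k) deltaA w /\
        solves_GE (Fmap f g t) (primal_dual_set (prod_set Z_)) w) /\
    (forall t t' w w', eball (s k) rA t -> eball (s k) rA t' ->
      eball (wstar k) deltaA w ->
      solves_GE (Fmap f g t) (primal_dual_set (prod_set Z_)) w ->
      eball (wstar k) deltaA w' ->
      solves_GE (Fmap f g t') (primal_dual_set (prod_set Z_)) w' ->
      enorm (w - w') <= lA * enorm (Fmap f g t w' - Fmap f g t' w')))
  (Hstep : forall k, enorm (s k.+1 - s k) <= rA)
  (Hwstar : forall k w,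
    (eball (wstar k) deltaA w /\
     solves_GE (Fmap f g (s k.+1)) (primal_dual_set (prod_set Z_)) w)
    <-> w = wstar k.+1)
  (lF : R) (HlF : 0 < lF)
  (HF : forall w t t', primal_dual_set (prod_set Z_) w -> Sp t -> Sp t' ->
    enorm (Fmap f g t w - Fmap f g t' w) <= lF * enorm (t - t'))
  (* strong regularity of (GE2) *)
  (rhot : R) (Hrhot : 0 < rhot)
  (HregB : forall rho', rhot < rho' -> forall k,
    strongly_regular (Gmap f g rho' (rsubmx (wstar k)) 0 (s k))
      (primal_dual_set (prod_set Z_)) (wstar k))
  (deltaB rB qB lB : R)
  (HdeltaB : 0 < deltaB) (HrB : 0 < rB) (HqB : 0 < qB) (HlB : 0 < lB)
  (HSB : forall k, eball (s k) rB `<=` Sp)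
  (HB : rhot < rho -> forall k,
    (forall d t, eball 0 qB d -> eball (s k) rB t ->
      exists! w, eball (wstar k) deltaB w /\
        solves_GE (Gmap f g rho (rsubmx (wstar k)) d t)
          (primal_dual_set (prod_set Z_)) w) /\
    (forall d d' t t' w w', eball 0 qB d -> eball 0 qB d' ->
      eball (s k) rB t -> eball (s k) rB t' ->
      eball (wstar k) deltaB w ->
      solves_GE (Gmap f g rho (rsubmx (wstar k)) d t)
        (primal_dual_set (prod_set Z_)) w ->
      eball (wstar k) deltaB w' ->
      solves_GE (Gmap f g rho (rsubmx (wstar k)) d' t')
        (primal_dual_set (prod_set Z_)) w' ->
      enorm (w - w') <=
        lB * enorm (Gmap f g rho (rsubmx (wstar k)) d t w'
                    - Gmap f g rho (rsubmx (wstar k)) d' t' w')))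
  (lG : R) (HlG : 0 < lG)
  (HG : forall k w d d' t t', primal_dual_set (prod_set Z_) w -> Sp t -> Sp t' ->
    enorm (Gmap f g rho (rsubmx (wstar k)) d t w
           - Gmap f g rho (rsubmx (wstar k)) d' t' w)
      <= lG * enorm (row_mx d t - row_mx d' t'))
  (* Lipschitz constant of the constraint and KL assumption *)
  (lg : R) (Hlg : 0 < lg)
  (HgLip : forall t z z', Sp t -> prod_set Z_ z -> prod_set Z_ z' ->
    enorm (g z t - g z' t) <= lg * enorm (z - z'))
  (delta thetah : R) (Hdelta : 0 < delta)
  (Hthetah : 2^-1 < thetah < 1)
  (HKL : KL_uniform (aug_lag_ind f g (prod_set Z_) rho) Sp delta thetah)
  (* the algorithm: zit k l is the l-th inner iterate at time instant k, and
     zinf k is the limit of the inner loop at time instant k run forever *)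
  (alpha : 'I_P -> R) (Halpha : forall i, 0 < alpha i)
  (M : nat) (HM : (1 <= M)%N)
  (zbar : nat -> 'rV[R]_(\sum_i n_ i)) (mubar : nat -> 'rV[R]_m)
  (zit : nat -> nat -> 'rV[R]_(\sum_i n_ i))
  (zinf : nat -> 'rV[R]_(\sum_i n_ i))
  (Hzit0 : forall k, zit k 0%N = zbar k)
  (Hsweep : forall k l,
    sweep Z_ (fun z => aug_lag f g rho z (mubar k) (s k.+1)) alpha
      (zit k l) (zit k l.+1))
  (Hzbar : forall k, zbar k.+1 = zit k M)
  (Hmubar : forall k, mubar k.+1 = mubar k + rho *: g (zbar k.+1) (s k.+1))
  (Hzinf : forall k, zit k l @[l --> \oo] --> zinf k)
  (Hcrit : forall k,
    critical (aug_lag_ind f g (prod_set Z_) rho (mubar k) (s k.+1)) (zinf k))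
  (C : R) (HC0 : 0 < C)
  (HC : forall k N, (1 <= N)%N -> eball (zinf k) delta (zbar k) ->
    enorm (zit k N - zinf k)
      <= C * N%:R `^ (- psi thetah) * enorm (zbar k - zinf k))
  (* the time instant k; Htrack makes precise that the critical point
     approached by the inner loop is the one near the reference solution *)
  (k : nat)
  (Htrack : eball (wstar k) deltaB
    (row_mx (zinf k) (mubar k + rho *: g (zinf k) (s k.+1))))
  (Hi : enorm (s k.+1 - s k) < Num.min rA (Num.min rB (qB * rho / (lA * lF))))
  (Hii : enorm (row_mx (zbar k) (mubar k) - wstar k) < qB * rho)
  (Hiii : rhot < rho)
  (Hiv : (1 + lG * lB / rho) * enorm (row_mx (zbar k) (mubar k) - wstar k)
         + lG * lB * enorm (s k.+1 - s k) < delta) :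
  enorm (row_mx (zbar k.+1) (mubar k.+1) - wstar k.+1)
    <= beta_w C lg lB lG thetah rho M
         * enorm (row_mx (zbar k) (mubar k) - wstar k)
       + beta_s C lg lB lG lA lF thetah rho M * enorm (s k.+1 - s k).
Proof.
set S := primal_dual_set (prod_set Z_) in HregA HA Hwstar HF HregB HB HG *.
set E := enorm (row_mx (zbar k) (mubar k) - wstar k).
set Ds := enorm (s k.+1 - s k).
set mus := rsubmx (wstar k).
have E_ge0 : 0 <= E by exact: enorm_ge0.
have Ds_ge0 : 0 <= Ds by exact: enorm_ge0.
have /and3P[Ds_rA Ds_rB Ds_q] : [&& Ds < rA, Ds < rB & Ds < qB * rho / (lA * lF)].
  by move: Hi; rewrite !lt_min.
have lAF_gt0 : 0 < lA * lF by exact: mulr_gt0.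
have lAFDs_q : lA * lF * Ds < qB * rho by rewrite mulrC -ltr_pdivlMr.
have enorm0_lt n r : 0 < r -> eball (0 : 'rV[R]_n) r 0.
  by rewrite /eball /= subr0 enorm0.
have eball_center n (x : 'rV[R]_n) r : 0 < r -> eball x r x.
  by rewrite /eball /= subrr enorm0.
have Sk := Hs k; have Sk1 := Hs k.+1.
have sk1A : eball (s k) rA (s k.+1) by [].
have sk1B : eball (s k) rB (s k.+1) by [].
have solk : solves_GE (Fmap f g (s k)) S (wstar k) := (HregA k).1.
have [wk1A solk1] := (Hwstar k (wstar k.+1)).2 erefl.
have [exA lipA] := HA k; have [exB lipB] := HB Hiii k.
have distA t t' w w' : eball (s k) rA t -> eball (s k) rA t' ->
    eball (wstar k) deltaA w -> solves_GE (Fmap f g t) S w ->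
    eball (wstar k) deltaA w' -> solves_GE (Fmap f g t') S w' ->
    enorm (w - w') <= lA * lF * enorm (t - t').
  move=> tA t'A wA solw w'A solw'; rewrite -mulrA.
  apply: le_trans (lipA _ _ _ _ tA t'A wA solw w'A solw') _.
  rewrite ler_pM2l //; apply: HF; [exact: solw'.1|exact: (HSA k)|exact: (HSA k)].
have distB d d' t t' w w' : eball 0 qB d -> eball 0 qB d' ->
    eball (s k) rB t -> eball (s k) rB t' ->
    eball (wstar k) deltaB w -> solves_GE (Gmap f g rho mus d t) S w ->
    eball (wstar k) deltaB w' -> solves_GE (Gmap f g rho mus d' t') S w' ->
    enorm (w - w') <= lB * lG * (enorm (d - d') + enorm (t - t')).
  move=> dq d'q tB t'B wB solw w'B solw'; rewrite -mulrA.
  apply: le_trans (lipB _ _ _ _ _ _ dq d'q tB t'B wB solw w'B solw') _.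
  rewrite ler_pM2l //.
  apply: le_trans (HG k _ _ _ _ _ solw'.1 (HSB k _ tB) (HSB k _ t'B)) _.
  by rewrite ler_pM2l // opp_row_mx add_row_mx enorm_row_mx_le.
have wk1_dist : enorm (wstar k.+1 - wstar k) <= lA * lF * Ds.
  by apply: distA => //; exact: eball_center.
pose d_ (w : 'rV[R]_(\sum_i n_ i + m)) := rho^-1 *: (rsubmx w - mus).
have d_dist w w' : enorm (d_ w - d_ w') <= enorm (w - w') / rho.
  rewrite -scalerBr opprB addrA subrK enormZ gtr0_norm ?invr_gt0 // mulrC.
  rewrite ler_pM2r ?invr_gt0 // -[rsubmx w - _](_ : rsubmx (w - w') = _).
    exact: enorm_rsubmx_le.
  by apply/rowP => j; rewrite !mxE.
have solB w t : solves_GE (Fmap f g t) S w -> solves_GE (Gmap f g rho mus (d_ w) t) S w.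
  by rewrite /solves_GE Gmap_Fmap.
have d_star : d_ (wstar k) = 0 by rewrite /d_ subrr scaler0.
(* The third bound in (i) enters here: the solution moves by at most [lA * lF * Ds < qB * rho], and
   [d_] contracts distances by [rho]. *)
have dk1_q : eball 0 qB (d_ (wstar k.+1)).
  rewrite /eball /= -d_star; apply: le_lt_trans (d_dist _ _) _.
  by rewrite ltr_pdivrMr //; exact: le_lt_trans lAFDs_q.
(* Along the segment [st], [w] follows the (GE1) solution in the ball of radius [deltaA], and [w']
   the (GE2) solution at [d_ (w t)] in the ball of radius [deltaB]. *)
have wk1B : eball (wstar k) deltaB (wstar k.+1).
  pose st (t : R) := s k + t *: (s k.+1 - s k).
  have st_dist t u : enorm (st t - st u) = `|t - u| * Ds.
    by rewrite /st opprD addrACA subrr add0r -scalerBl enormZ.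
  have st0 : st 0 = s k by rewrite /st scale0r addr0.
  have st1 : st 1 = s k.+1 by rewrite /st scale1r addrC subrK.
  have st_near t : t \in `[0, 1]%R -> enorm (st t - s k) <= Ds.
    rewrite in_itv /= => /andP[t_ge0 t_le1].
    by rewrite -st0 st_dist subr0 ger0_norm // ler_piMl.
  have stA t : t \in `[0, 1]%R -> eball (s k) rA (st t).
    by move=> /st_near; rewrite /eball /= => /le_lt_trans; exact.
  have stB t : t \in `[0, 1]%R -> eball (s k) rB (st t).
    by move=> /st_near; rewrite /eball /= => /le_lt_trans; exact.
  (* Outside [0, 1] the relation to be selected from is vacuous, and 0 merely witnesses it. *)
  have [w w_sol] : {w : R -> 'rV_(\sum_i n_ i + m) & forall t, t \in `[0, 1]%R ->
      eball (wstar k) deltaA (w t) /\ solves_GE (Fmap f g (st t)) S (w t)}.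
    apply: (@choice _ _ (fun t v => t \in `[0, 1]%R ->
      eball (wstar k) deltaA v /\ solves_GE (Fmap f g (st t)) S v)) => t.
    have [/stA/exA[v [v_sol _]]|_] := boolP (t \in `[0, 1]%R); first by exists v.
    by exists 0.
  have dw_q t : t \in `[0, 1]%R -> eball 0 qB (d_ (w t)).
    move=> t01; have [wA solw] := w_sol t t01.
    rewrite /eball /= -d_star; apply: le_lt_trans (d_dist _ _) _.
    rewrite ltr_pdivrMr //; apply: le_lt_trans lAFDs_q.
    have := distA (st t) (s k) (w t) (wstar k).
    move=> /(_ (stA t t01) (eball_center _ _ _ HrA) wA solw).
    move=> /(_ (eball_center _ _ _ HdeltaA) solk) /le_trans; apply.
    by rewrite ler_pM2l //; exact: st_near.
  have [w' w'_sol] : {w' : R -> 'rV_(\sum_i n_ i + m) & forall t, t \in `[0, 1]%R ->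
      eball (wstar k) deltaB (w' t) /\
      solves_GE (Gmap f g rho mus (d_ (w t)) (st t)) S (w' t)}.
    apply: (@choice _ _ (fun t v => t \in `[0, 1]%R -> eball (wstar k) deltaB v /\
      solves_GE (Gmap f g rho mus (d_ (w t)) (st t)) S v)) => t.
    have [t01|_] := boolP (t \in `[0, 1]%R); last by exists 0.
    by have [v [v_sol _]] := exB _ _ (dw_q t t01) (stB t t01); exists v.
  have i0 : (0 : R) \in `[0, 1]%R by rewrite in_itv /= lexx ler01.
  have i1 : (1 : R) \in `[0, 1]%R by rewrite in_itv /= lexx ler01.
  have <- : w 1 = wstar k.+1.
    by apply/(Hwstar k); rewrite -st1; exact: w_sol.
  have w_lip : {in `[0, 1]%R &, forall t u, enorm (w t - w u) <= lA * lF * Ds * `|t - u|}.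
    move=> t u t01 u01; have [wtA solt] := w_sol t t01.
    have [wuA solu] := w_sol u u01.
    apply: le_trans (distA _ _ _ _ (stA t t01) (stA u u01) wtA solt wuA solu) _.
    by rewrite st_dist -[leRHS]mulrA (mulrC Ds).
  (* [w'] depends on time through both [d_ (w t)] and [st t], hence the two terms in its Lipschitz
     constant. *)
  apply: (@eball_continuation _ _ _ _ (lA * lF * Ds)
      (lB * lG * (lA * lF * Ds / rho + Ds)) w w') => //.
  - move=> t u t01 u01; have [wtB solt] := w'_sol t t01.
    have [wuB solu] := w'_sol u u01.
    apply: le_trans (distB _ _ _ _ _ _ (dw_q t t01) (dw_q u u01)
      (stB t t01) (stB u u01) wtB solt wuB solu) _.
    rewrite -[leRHS]mulrA ler_pM2l ?mulr_gt0 // mulrDl st_dist (mulrC Ds) lerD2r.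
    apply: le_trans (d_dist _ _) _.
    rewrite -[leRHS]mulrA (mulrC rho^-1) mulrA ler_pM2r ?invr_gt0 //.
    exact: w_lip.
  - by move=> t t01; have [] := w'_sol t t01.
  (* By [solB], [w t] also solves the instance of (GE2) defining [w' t]; uniqueness in the ball of
     radius [deltaB] identifies them. *)
  - move=> t t01 wtB; have [wt'B solt'] := w'_sol t t01.
    have [_ solt] := w_sol t t01.
    have [v [_ v_uniq]] := exB _ _ (dw_q t t01) (stB t t01).
    have /v_uniq <- : eball (wstar k) deltaB (w t) /\
      solves_GE (Gmap f g rho mus (d_ (w t)) (st t)) S (w t).
      by split => //; exact: solB.
    exact: v_uniq.
  (* At time 0 both [w 0] and [wstar k] solve (GE1) at [s k], so [distA] makes their distance 0. *)
  - have [wA sol0] := w_sol 0 i0; rewrite st0 in sol0.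
    have := distA _ _ _ _ (eball_center _ _ _ HrA) (eball_center _ _ _ HrA)
      wA sol0 (eball_center _ _ _ HdeltaA) solk.
    by rewrite subrr enorm0 mulr0 /eball /= => /le_lt_trans; apply.
pose winf := row_mx (zinf k) (mubar k + rho *: g (zinf k) (s k.+1)).
pose d := rho^-1 *: (mubar k - mus).
have normal_inf := critical_aug_lag_normal_cone HZconvex HfC2 (Hg _ Sk1) (Hcrit k).
have solinf : solves_GE (Gmap f g rho mus d (s k.+1)) S winf.
  apply: solves_GE_row_mx normal_inf; rewrite /Gmap row_mxKl row_mxKr.
  (* The second component cancels: the multiplier of [winf] exceeds [mubar k] by exactly [rho *: g],
     and [d] absorbs the rest. *)
  congr row_mx; rewrite -addrA -scalerDr addrA subrK opprD addrA subrr add0r.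
  by rewrite scalerN scalerA mulVf ?gt_eqF // scale1r subrr.
have d_q : enorm d <= E / rho.
  rewrite /d enormZ gtr0_norm ?invr_gt0 // mulrC ler_pM2r ?invr_gt0 //.
  rewrite -[_ - mus](_ : rsubmx (row_mx (zbar k) (mubar k) - wstar k) = _).
    exact: enorm_rsubmx_le.
  by rewrite /mus -{1}(hsubmxK (wstar k)) opp_row_mx add_row_mx row_mxKr.
(* Hypothesis (ii) makes the perturbation [d] admissible. *)
have d_ball : eball 0 qB d.
  by rewrite /eball /= subr0; apply: le_lt_trans d_q _; rewrite ltr_pdivrMr.
have inf_star : enorm (winf - wstar k) <= lB * lG * (E / rho + Ds).
  have zero_ball : eball (0 : 'rV[R]_m) qB (d_ (wstar k)).
    by rewrite d_star; exact: eball_center.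
  apply: le_trans (distB _ _ _ _ _ _ d_ball zero_ball sk1B (eball_center _ _ _ HrB)
    Htrack solinf (eball_center _ _ _ HdeltaB) (solB _ _ solk)) _.
  by rewrite ler_pM2l ?mulr_gt0 // d_star subr0 lerD2r.
(* Both points belong to the parameter [s k.+1], so only the perturbations differ; their difference
   is bounded through 0, which is [d_ (wstar k)]. *)
have inf_star1 : enorm (winf - wstar k.+1) <= lB * lG * ((E + lA * lF * Ds) / rho).
  apply: le_trans (distB _ _ _ _ _ _ d_ball dk1_q sk1B sk1B
    Htrack solinf wk1B (solB _ _ solk1)) _.
  rewrite ler_pM2l ?mulr_gt0 // subrr enorm0 addr0 mulrDl.
  apply: le_trans (ler_enorm_distD 0 _ _) _; rewrite subr0 lerD // -d_star.
  apply: le_trans (d_dist _ _) _.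
  by rewrite ler_pM2r ?invr_gt0 // enorm_distC.
have z_inf : enorm (zbar k - zinf k) <= E + lB * lG * (E / rho + Ds).
  rewrite -[_ - zinf k](_ : lsubmx (row_mx (zbar k) (mubar k) - winf) = _).
    apply: le_trans (enorm_lsubmx_le _) _.
    apply: le_trans (ler_enorm_distD (wstar k) _ _) _.
    by rewrite lerD2l enorm_distC.
  by rewrite opp_row_mx add_row_mx row_mxKl.
(* The bound [z_inf] is, after regrouping, the left-hand side of (iv). *)
have z_ball : eball (zinf k) delta (zbar k).
  rewrite /eball /=; apply: le_lt_trans z_inf _; apply: le_lt_trans Hiv.
  by rewrite le_eqVlt; apply/orP; left; apply/eqP; rewrite -/E -/Ds; ring.
have zk1_inf : enorm (zbar k.+1 - zinf k) <=
    C * M%:R `^ (- psi thetah) * (E + lB * lG * (E / rho + Ds)).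
  rewrite Hzbar; apply: le_trans (HC k M HM z_ball) _.
  by rewrite ler_wpM2l // mulr_ge0 ?powR_ge0 // ltW.
(* Since [M >= 1], the last iterate comes out of a sweep, whose block minimisers are feasible. *)
have zk1_Z : prod_set Z_ (zbar k.+1).
  by move=> i; rewrite Hzbar -(prednK HM); exact: (Hsweep k M.-1 i).1.
(* Both multipliers are [mubar k] plus [rho] times a constraint value, so they differ by at most
   [rho * lg] times the primal distance. *)
have wk1_inf : enorm (row_mx (zbar k.+1) (mubar k.+1) - winf) <=
    (1 + rho * lg) * enorm (zbar k.+1 - zinf k).
  rewrite opp_row_mx add_row_mx; apply: le_trans (enorm_row_mx_le _ _) _.
  rewrite mulrDl mul1r lerD2l Hmubar opprD addrACA subrr add0r -scalerBr.
  rewrite enormZ gtr0_norm // -mulrA ler_pM2l //.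
  by apply: HgLip => //; exact: normal_inf.1.
apply: le_trans (ler_enorm_distD winf _ _) _.
(* Collecting the coefficients of [E] and [Ds] in this bound gives exactly [beta_w] and [beta_s]. *)
apply: (@le_trans _ _ ((1 + rho * lg) * (C * M%:R `^ (- psi thetah) *
  (E + lB * lG * (E / rho + Ds))) + lB * lG * ((E + lA * lF * Ds) / rho))).
  rewrite lerD //; apply: le_trans wk1_inf _.
  by rewrite ler_pM2l // addr_gt0 // mulr_gt0.
by rewrite /beta_w /beta_s le_eqVlt; apply/orP; left; apply/eqP; ring.
Qed.
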